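(* Let $A\in\mathbb{Z}^{m\times n}$ and let $A=\tilde A+UW$ be a $k$-row affine TU decomposition of $A$, with $W\in\{0,\pm1\}^{k\times n}$. Let $b\in\mathbb{Z}^m$, $\ell\in(\mathbb{Z}\cup\{-\infty\})^n$ and $u\in(\mathbb{Z}\cup\{\infty\})^n$ with $\ell\le u$. Then $$\operatorname{conv}\left(\{x\in\mathbb{R}^n\mid \ell\le x\le u,\ Ax\le b,\ Wx\in\mathbb{Z}^k\}\right)$$ is an integral polyhedron. In particular, the polyhedron $P=\{x\in\mathbb{R}^n\mid \ell\le x\le u,\ Ax\le b\}$ and the matrix $W$ satisfy $$\operatorname{conv}(P\cap\mathbb{Z}^n)=\operatorname{conv}(\{x\in P\mid Wx\in\mathbb{Z}^k\}).$$
   Context: A matrix is totally unimodular (TU) if each of its square submatrices has determinant in $\{0,\pm1\}$. A matrix $A\in\mathbb{Z}^{m\times n}$ admits a $k$-row affine TU decomposition if there exist $U\in\mathbb{Z}^{m\times k}$ and $W\in\{0,\pm1\}^{k\times n}$ such that the stacked matrix $\begin{bmatrix}\tilde A\\ W\end{bmatrix}$ is totally unimodular, where $\tilde A\in\mathbb{Z}^{m\times n}$ is the unique matrix with $A=\tilde A+UW$; the expression $A=\tilde A+UW$ is then called an affine TU decomposition. A polyhedron $Q\subseteq\mathbb{R}^n$ is called integral if $Q=\operatorname{conv}(Q\cap\mathbb{Z}^n)$. Inequalities between vectors are componentwise. *)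

(* Defs.v *)
From mathcomp Require Import all_boot all_order all_algebra.
From mathcomp Require Import all_classical all_reals.
From mathcomp Require Import convex.

Set Implicit Arguments.
Unset Strict Implicit.
Unset Printing Implicit Defensive.

Import Order.TTheory GRing.Theory Num.Theory.

Local Open Scope classical_set_scope.
Local Open Scope ring_scope.

(* A square submatrix is given by increasing choices [f], [g] of its rows and
   columns; for [p = 0] the determinant is 1. *)
Definition totally_unimodular (m n : nat) (A : 'M[int]_(m, n)) : Prop :=
  forall (p : nat) (f : 'I_p -> 'I_m) (g : 'I_p -> 'I_n),
    {homo f : i j / (i < j)%N} -> {homo g : i j / (i < j)%N} ->
    \det (mxsub f g A) \in [:: 0; 1; -1].

(* [At] is the matrix written A with a tilde. *)
Definition affine_TU_decomposition (m n k : nat) (A At : 'M[int]_(m, n))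
    (U : 'M[int]_(m, k)) (W : 'M[int]_(k, n)) : Prop :=
  [/\ A = At + U *m W,
      forall i j, W i j \in [:: 0; 1; -1]
    & totally_unimodular (col_mx At W)].

Section Polyhedra.
Variable R : realType.

Definition cv_le (n : nat) (x y : 'cV[R]_n) : Prop :=
  forall i, x i 0 <= y i 0.

Definition int_points (n : nat) : set 'cV[R]_n :=
  [set x : 'cV[R]_n | forall i, x i 0 \is a Num.int].

Definition convex_hull (n : nat) (S : set 'cV[R]_n) : set 'cV[R]_n :=
  smallest (@convex_set R 'cV[R]_n) S.

Definition polyhedron (n : nat) (Q : set 'cV[R]_n) : Prop :=
  exists (p : nat) (M : 'M[R]_(p, n)) (d : 'cV[R]_p),
    Q = [set x : 'cV[R]_n | cv_le (M *m x) d].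

Definition integral_polyhedron (n : nat) (Q : set 'cV[R]_n) : Prop :=
  polyhedron Q /\ Q = convex_hull (Q `&` @int_points n).

Definition real_mx (m n : nat) (A : 'M[int]_(m, n)) : 'M[R]_(m, n) :=
  map_mx intr A.

(* Bounds are extended integers, compared with [x] in the extended reals. *)
Definition bounded_system (m n : nat) (A : 'M[int]_(m, n)) (b : 'cV[int]_m)
    (l u : 'cV[\bar int]_n) : set 'cV[R]_n :=
  [set x : 'cV[R]_n |
    (forall j, (er_map intr (l j 0%R) <= (x j 0%R)%:E)%E /\
                ((x j 0%R)%:E <= er_map intr (u j 0%R))%E) /\
    cv_le (real_mx A *m x) (real_mx b)].

End Polyhedra.

Arguments int_points R n : clear implicits.
Arguments real_mx R {m n} A.
Arguments bounded_system R {m n} A b l u.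

(* Main.v *)
(** Split [S] according to the value [z = W x].  On the slice [W x = z] the
    system [A x <= b] reads [At x <= b - U z], whose constraint matrix [At; W] is
    totally unimodular, so every point of the slice is a convex combination of
    integer points of the same slice.  For this, a fractional [x] is moved in both
    directions along a kernel vector of the rows that are already integral until
    one more row becomes integral; no row ever leaves the interval between the
    floor and the ceiling of its value at [x], so no vertices are needed and
    unbounded polyhedra cause no trouble.

    That the hull is a polyhedron is Meyer's theorem.  By Dickson's lemma applied
    to the slacks and to the positive and negative parts of the coordinates, the
    integer points are those of the form [f + r] with [f] in a finite set and [r]
    a nonnegative combination of finitely many integer recession directions.
    The homogenized hull is thus a finitely generated cone, which is polyhedral
    by Fourier-Motzkin elimination. *)

Require Import Defs.
From mathcomp Require Import all_boot all_order all_algebra.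
From mathcomp Require Import all_classical all_reals.
From mathcomp Require Import convex interval_inference.
From mathcomp Require Import ring lra zify.

Set Implicit Arguments.
Unset Strict Implicit.
Unset Printing Implicit Defensive.

Import Order.TTheory GRing.Theory Num.Theory.

Local Open Scope classical_set_scope.
Local Open Scope ring_scope.

(** * Convex hulls and finitely generated cones *)

Section ConvexHull.
Variables (R : realType) (n : nat).
Implicit Types (S K : set 'cV[R]_n) (x y : 'cV[R]_n) (a b t : R).

Lemma convex_setP K :
  convex_set (K : set (convex_lmodType 'cV[R]_n)) <->
  forall x y a b, 0 <= a -> 0 <= b -> a + b = 1 -> K x -> K y ->
    K (a *: x + b *: y).
Proof.
split=> [cK x y a b a0 b0 ab Kx Ky | cK x y t /set_mem Kx /set_mem Ky].
  have a1 : a <= 1 by lra.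
  have -> : b = 1 - a by lra.
  by have /set_mem := cK x y (Itv01 a0 a1) (mem_set Kx) (mem_set Ky).
apply/mem_set/cK => //; last first.
  by change (t%:inum + (1 - t%:inum) = 1); rewrite addrC subrK.
by change (0 <= 1 - t%:inum); rewrite subr_ge0 le1.
Qed.

Lemma convex_hull_sub S : S `<=` convex_hull S.
Proof. exact: sub_gen_smallest. Qed.

Lemma convex_hull_min S K :
  convex_set (K : set (convex_lmodType 'cV[R]_n)) -> S `<=` K ->
  convex_hull S `<=` K.
Proof. exact: smallest_sub. Qed.

Lemma convex_hull_convex S :
  convex_set (convex_hull S : set (convex_lmodType 'cV[R]_n)).
Proof.
apply/convex_setP => x y a b a0 b0 ab hx hy K [cK SK].
by move/convex_setP: (cK); apply=> //; [apply: hx | apply: hy].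
Qed.

Lemma convex_hull_comb S x y a b : 0 <= a -> 0 <= b -> a + b = 1 ->
  convex_hull S x -> convex_hull S y -> convex_hull S (a *: x + b *: y).
Proof. by move: (convex_hull_convex (S := S)) => /convex_setP; apply. Qed.

Lemma convex_hull_incl S K : S `<=` convex_hull K ->
  convex_hull S `<=` convex_hull K.
Proof. by move=> h; apply: convex_hull_min h; exact: convex_hull_convex. Qed.

Lemma convex_hull_translate S h : (forall x, S x -> S (x + h)) ->
  forall x, convex_hull S x -> convex_hull S (x + h).
Proof.
move=> Sh x; apply: (@convex_hull_min _ [set x | convex_hull S (x + h)]).
  apply/convex_setP => y z a b a0 b0 ab /= hy hz.
  have -> : a *: y + b *: z + h = a *: (y + h) + b *: (z + h).
    by rewrite !scalerDr addrACA -scalerDl ab scale1r.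
  exact: convex_hull_comb.
by move=> y Sy; apply: convex_hull_sub; exact: Sh.
Qed.

(** Repeated translation reaches the natural multiples of [h]. A real [t] is below some natural [N],
    and [x + t *: h] lies on the segment from [x] to [x + N%:R *: h]. *)
Lemma convex_hull_ray S h : (forall x, S x -> S (x + h)) ->
  forall x t, 0 <= t -> convex_hull S x -> convex_hull S (x + t *: h).
Proof.
move=> Sh x t t0 Sx.
have tr N : convex_hull S (x + N%:R *: h).
  elim: N => [|N IH]; first by rewrite scale0r addr0.
  by rewrite -natr1 scalerDl scale1r addrA; exact: convex_hull_translate.
have tN := archi_boundP t0.
set N := Num.Def.archi_bound t in tN.
have N0 : 0 < N%:R :> R by exact: le_lt_trans t0 tN.
have -> : x + t *: h = (t / N%:R) *: (x + N%:R *: h) + (1 - t / N%:R) *: x.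
  rewrite scalerDr scalerA divfK ?gt_eqF// addrAC -scalerDl.
  by rewrite [_ + (1 - _)]addrC subrK scale1r.
apply: convex_hull_comb => //.
- by rewrite divr_ge0 // ltW.
- by rewrite subr_ge0 ler_pdivrMr // mul1r ltW.
- by rewrite addrC subrK.
Qed.

End ConvexHull.

Section Cones.
Variables (R : realType) (n : nat).
Implicit Types (g h x y : 'cV[R]_n) (a p q : 'rV[R]_n) (t : R).

(** Peeling off one generator at a time makes each new generator a single existential variable [t],
    which is exactly what Fourier-Motzkin elimination removes. *)
Fixpoint cone (gs : seq 'cV[R]_n) : set 'cV[R]_n :=
  if gs is g :: gs' then [set y | exists2 t, 0 <= t & cone gs' (y - t *: g)]
  else [set 0].

Definition polycone (L : seq 'rV[R]_n) : set 'cV[R]_n :=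
  [set y | forall a, a \in L -> (a *m y) 0 0 <= 0].

Lemma cone0 gs : cone gs 0.
Proof. by elim: gs => //= g gs IH; exists 0; rewrite ?scale0r ?subr0. Qed.

Lemma coneD gs x y : cone gs x -> cone gs y -> cone gs (x + y).
Proof.
elim: gs x y => [x y -> -> | g gs IH x y [s s0 gx] [t t0 gy]] /=.
  by rewrite addr0.
exists (s + t); first exact: addr_ge0.
by rewrite scalerDl opprD addrACA; exact: IH.
Qed.

Lemma coneZ gs x t : 0 <= t -> cone gs x -> cone gs (t *: x).
Proof.
move=> t0; elim: gs x => [x -> | g gs IH x [s s0 gx]] /=; first by rewrite scaler0.
exists (t * s); first exact: mulr_ge0.
by rewrite -scalerA -scalerBr; exact: IH.
Qed.

Lemma cone_gen gs g : g \in gs -> cone gs g.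
Proof.
elim: gs => //= h gs IH; rewrite in_cons => /orP[/eqP -> | /IH gg].
  by exists 1 => //; rewrite scale1r subrr; exact: cone0.
by exists 0 => //; rewrite scale0r subr0.
Qed.

(* Eliminating t >= 0 from the constraints a (y - t h) <= 0: a with a h < 0
   bounds t from above, a with a h > 0 bounds it from below. *)
Definition fourier_motzkin (L : seq 'rV[R]_n) h : seq 'rV[R]_n :=
  let val a := (a *m h) 0 0 in
  [seq a <- L | val a <= 0] ++
  [seq val p *: q - val q *: p | p <- [seq a <- L | 0 < val a],
                                 q <- [seq a <- L | val a < 0]].

Lemma fourier_motzkinP L h y :
  polycone (fourier_motzkin L h) y <->
  exists2 t, 0 <= t & polycone L (y - t *: h).
Proof.
have valB a t : (a *m (y - t *: h)) 0 0 = (a *m y) 0 0 - t * (a *m h) 0 0.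
  by rewrite mulmxBr -scalemxAr !mxE.
have valC p q : (((p *m h) 0 0 *: q - (q *m h) 0 0 *: p) *m y) 0 0 =
    (p *m h) 0 0 * (q *m y) 0 0 - (q *m h) 0 0 * (p *m y) 0 0.
  by rewrite mulmxBl -!scalemxAl !mxE.
split=> [FMy | [t t0 Ly] a].
  (* The largest of the lower bounds on [t]; the default 0 accounts for [0 <= t]. *)
  pose t := \big[Num.max/0]_(p <- [seq a <- L | 0 < (a *m h) 0 0])
     ((p *m y) 0 0 / (p *m h) 0 0).
  have t0 : 0 <= t.
    by rewrite /t; elim/big_rec: _ => // p s _ s0; rewrite le_max s0 orbT.
  exists t => // a aL; rewrite valB subr_le0.
  have [ah | ah | ah] := ltgtP ((a *m h) 0 0) 0; last first.
  - rewrite ah mulr0; apply: FMy.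
    by rewrite mem_cat mem_filter ah lexx aL.
  - rewrite -ler_pdivrMr // /t big_seq_cond.
    have : a \in [seq a <- L | 0 < (a *m h) 0 0] by rewrite mem_filter ah.
    rewrite -big_seq_cond; elim: [seq _ <- _ | _] => //= p s IH.
    rewrite in_cons big_cons le_max => /orP[/eqP <-|/IH ->]; last by rewrite orbT.
    by rewrite lexx.
  (* An upper bound is compared with each lower bound by the combined constraint of the pair, and
     with 0 by [a] itself, which the first list keeps. *)
  - rewrite -ler_ndivlMr // /t.
    rewrite big_seq_cond; elim/big_rec: _ => [|p s /andP[]].
      rewrite ler_ndivlMr // mul0r; apply: FMy.
      by rewrite mem_cat mem_filter aL ltW.
    rewrite mem_filter => /andP[ph pL] _ hs; rewrite ge_max hs andbT.
    rewrite ler_pdivrMr // mulrAC ler_ndivlMr // -subr_le0.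
    rewrite [X in _ - X]mulrC -(mulrC ((p *m h) 0 0)) -valC; apply: FMy.
    rewrite mem_cat; apply/orP; right.
    by apply: allpairs_f; rewrite mem_filter ?ph ?ah.
rewrite mem_cat => /orP[|/allpairsP[[p q] /= []]].
  rewrite mem_filter => /andP[ah aL]; have := Ly _ aL; rewrite valB.
  move/le_trans: (mulr_ge0_le0 t0 ah) => _; have := mulr_ge0_le0 t0 ah; lra.
rewrite !mem_filter => /andP[ph pL] /andP[qh qL] ->; rewrite valC.
have := Ly _ pL; have := Ly _ qL; rewrite !valB => Lq Lp; nra.
Qed.

Lemma cone_polyhedral gs : exists L, cone gs = polycone L.
Proof.
elim: gs => [|g gs [L Lgs]].
  (* The zero cone: every coordinate is forced to be both at most 0 and at least 0. *)
  exists ([seq delta_mx 0 i | i : 'I_n] ++ [seq - delta_mx 0 i | i : 'I_n]).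
  have dE i y : ((delta_mx 0 i : 'rV[R]_n) *m y) 0 0 = y i 0.
    by rewrite -rowE mxE.
  rewrite eqEsubset; split=> [y -> a _ | y Ly]; first by rewrite mulmx0 mxE.
  apply/matrixP => i j; rewrite ord1 mxE; apply/eqP.
  rewrite eq_le -{1}dE Ly; last by rewrite mem_cat map_f ?mem_enum.
  rewrite -oppr_le0 -dE.
  have := Ly (- delta_mx 0 i); rewrite mulNmx mxE; apply.
  by rewrite mem_cat (map_f (fun i => - delta_mx 0 i)) ?mem_enum ?orbT.
exists (fourier_motzkin L g); rewrite eqEsubset; split=> y.
  by rewrite /= Lgs => /fourier_motzkinP.
by move/fourier_motzkinP => [t t0 hy]; exists t => //; rewrite Lgs.
Qed.

End Cones.

(** * Integer points of a polyhedron *)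

(** Induction on the list of measures. Let [F] serve the tail [ss] and let [N] be the largest value
    of [s] on [F]. Elements with [s e >= N] are dominated by [F]; the others lie in the finitely
    many levels [s = c] with [c < N], each of which has its own finite set by induction. *)
Lemma dickson (T : choiceType) (ss : seq (T -> nat)) (E : set T) :
  exists2 F : seq T, {in F, forall f, E f} &
    forall e, E e -> exists2 f, f \in F & all (fun s => s f <= s e)%N ss.
Proof.
elim: ss E => [|s ss IH] E.
  have [[e0 Ee0]|E0] := pselect (exists e, E e).
    by exists [:: e0] => [f|e _]; [rewrite inE => /eqP -> | exists e0; rewrite ?inE].
  by exists [::] => // e Ee; case: E0; exists e.
have [F FE Fmin] := IH E.
have /choice[G GP] (c : nat) : exists G : seq T,
    {in G, forall f, E f /\ s f = c} /\
    forall e, E e -> s e = c -> exists2 f, f \in G & all (fun s => s f <= s e)%N ss.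
  have [G GE Gmin] := IH [set e | E e /\ s e = c].
  by exists G; split=> // e Ee sec; exact: Gmin.
pose N := (\max_(f <- F) s f)%N.
exists (F ++ flatten [seq G c | c <- iota 0 N]) => [f | e Ee].
  rewrite mem_cat => /orP[/FE // | /flatten_mapP[c _ /(GP c).1[]]] //.
have [Nse | seN] := leqP N (s e).
  have [f fF fe] := Fmin _ Ee; exists f; first by rewrite mem_cat fF.
  rewrite /= fe andbT; apply: leq_trans Nse.
  by rewrite /N; elim: (F) fF => //= g F' IHF;
    rewrite in_cons big_cons leq_max => /orP[/eqP <-|/IHF ->]; rewrite ?leqnn ?orbT.
have [f fG fe] := (GP (s e)).2 _ Ee erefl.
exists f; last by rewrite /= ((GP _).1 _ fG).2 leqnn fe.
by rewrite mem_cat; apply/orP; right; apply/flatten_mapP; exists (s e);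
  rewrite ?mem_iota.
Qed.

Section IntegerPoints.
Variables (p n : nat) (M : 'M[int]_(p, n)).

Let pos (z : int) : nat := if 0 <= z then `|z|%N else 0%N.

(* Comparing positive and negative parts separately makes [e - f] agree in sign
   with [e], so that absolute values add up. *)
Lemma conformal_minimal (d : 'cV[int]_p) (Q : set 'cV[int]_n) :
  exists2 F : seq 'cV[int]_n,
    {in F, forall f, (forall i, (M *m f) i 0 <= d i 0) /\ Q f} &
    forall e, (forall i, (M *m e) i 0 <= d i 0) -> Q e ->
      exists2 f, f \in F & (forall i, (M *m (e - f)) i 0 <= 0) /\
        (forall j, absz (e j 0) = (absz ((e - f)%R j 0%R) + absz (f j 0%R))%N).
Proof.
pose ss : seq ('cV[int]_n -> nat) :=
  [seq fun z : 'cV[int]_n => pos (z j 0) | j <- enum 'I_n] ++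
  [seq fun z : 'cV[int]_n => pos (- z j 0) | j <- enum 'I_n] ++
  [seq fun z : 'cV[int]_n => absz ((d - M *m z)%R i 0) | i <- enum 'I_p].
have [F FE Fmin] := dickson ss [set z | (forall i, (M *m z) i 0 <= d i 0) /\ Q z].
exists F => // e eE Qe; have [f fF] := Fmin e (conj eE Qe).
rewrite !all_cat => /and3P[/allP hp /allP hn /allP hs].
(* Feasible points have nonnegative slacks, so comparing absolute values compares the slacks
   themselves. *)
exists f => //; have slack (a b c : int) : a <= c -> b <= c ->
    (absz (c - a) <= absz (c - b))%N -> b - a <= 0 by lia.
have conformal (a b : int) : (pos a <= pos b -> pos (- a) <= pos (- b) ->
    absz b = absz (b - a)%R + absz a)%N by rewrite /pos; do 4 case: ifP; lia.
split=> [i | j].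
  have := hs _ (map_f _ (mem_enum _ i)); have := eE i; have := (FE _ fF).1 i.
  by rewrite /= mulmxBr !mxE => fd ed /(slack _ _ _ fd ed).
rewrite !mxE; apply: conformal; first exact: hp _ (map_f _ (mem_enum _ j)).
exact: hn _ (map_f _ (mem_enum _ j)).
Qed.

(** Subtracting a conformally smaller nonzero solution strictly lowers the sum of the absolute
    values of the entries, so the descent ends at 0. *)
Lemma hilbert_basis (R : realType) :
  exists2 H : seq 'cV[int]_n,
    {in H, forall h i, (M *m h) i 0 <= 0} &
    forall r, (forall i, (M *m r) i 0 <= 0) ->
      cone [seq real_mx R h | h <- H] (real_mx R r).
Proof.
have [H HP Hmin] := conformal_minimal 0 [set z | z != 0].
exists H => [h /HP[hM _] i | r]; first by have := hM i; rewrite [leRHS]mxE.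
have [N] := ubnP (\sum_j absz (r j 0%R))%N; elim: N r => // N IH r rN rM.
have [-> | r0] := eqVneq r 0; first by rewrite /real_mx map_mx0; exact: cone0.
have [|h hH [hM habs]] := Hmin r _ r0; first by move=> i; rewrite [leRHS]mxE.
rewrite -[r](subrK h) /real_mx map_mxD; apply: coneD; last first.
  by apply: cone_gen; rewrite (map_f (real_mx R)).
apply: IH => [|i]; last exact: hM.
have [_ h0] := HP _ hH.
have /matrix0Pn[j [j' hj]] : h != 0 by []; rewrite ord1 in hj.
rewrite ltnS in rN; apply: leq_trans rN; rewrite (eq_bigr _ (fun j _ => habs j)).
rewrite big_split /=.
rewrite -addn1 leq_add2l (bigD1 j) //= ltn_addr // lt0n absz_eq0; exact: hj.
Qed.

End IntegerPoints.

(** * Homogenization and polyhedrality of the integer hull *)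

Section IntegerHull.
Variable R : realType.

Lemma cone_min n (gs : seq 'cV[R]_n) (K : set 'cV[R]_n) :
  K 0 -> (forall x y, K x -> K y -> K (x + y)) ->
  (forall x t, 0 <= t -> K x -> K (t *: x)) ->
  {in gs, forall g, K g} -> cone gs `<=` K.
Proof.
move=> K0 KD KZ; elim: gs => [_ x -> // | g gs IH Kgs x /= [t t0 gx]].
rewrite -[x](subrK (t *: g)); apply: KD.
  by apply: IH gx => h hgs; apply: Kgs; rewrite in_cons hgs orbT.
by apply: KZ => //; apply: Kgs; rewrite in_cons eqxx.
Qed.

(** The cone over [K] placed at height 1, the height being the last coordinate. At height 0 stand
    the directions along which [K] recedes. *)
Definition homogenization n (K : set 'cV[R]_n) : set 'cV[R]_(n + 1) :=
  [set v : 'cV[R]_(n + 1) | let s : R := dsubmx v 0 0 in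
    (0 < s /\ K (s^-1 *: usubmx v)) \/
    (s = 0 /\ forall z t, K z -> 0 <= t -> K (z + t *: usubmx v))].

(** The homogenization is itself closed under sums and nonnegative scaling: two vectors of positive
    height are averaged with weights proportional to their heights, and a vector of height 0 only
    shifts along a recession direction. *)
Lemma cone_homogenization n (K : set 'cV[R]_n) (gs : seq 'cV[R]_(n + 1)) :
  convex_set (K : set (convex_lmodType 'cV[R]_n)) ->
  {in gs, forall g, homogenization K g} -> cone gs `<=` homogenization K.
Proof.
pose top (v : 'cV[R]_(n + 1)) : R := dsubmx v 0 0.
have topD x y : top (x + y) = top x + top y by rewrite /top linearD mxE.
have topZ t x : top (t *: x) = t * top x by rewrite /top linearZ mxE.
have subD (x y : 'cV[R]_(n + 1)) : usubmx (x + y) = usubmx x + usubmx y.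
  exact: linearD.
have subZ t (x : 'cV[R]_(n + 1)) : usubmx (t *: x) = t *: usubmx x.
  exact: linearZ.
move=> /convex_setP cK.
have homE v : homogenization K v =
  ((0 < top v /\ K ((top v)^-1 *: usubmx v)) \/
   (top v = 0 /\ forall z t, K z -> 0 <= t -> K (z + t *: usubmx v))) by [].
apply: cone_min.
- by right; rewrite /top !linear0 mxE; split=> // z t Kz _; rewrite scaler0 addr0.
- have sum0 x y : 0 < top x -> top y = 0 ->
      K ((top x)^-1 *: usubmx x) ->
      (forall z t, K z -> 0 <= t -> K (z + t *: usubmx y)) ->
      homogenization K (x + y).
    move=> x0 y0 Kx Ky; rewrite homE; left; rewrite topD subD y0 addr0; split=> //.
    by rewrite scalerDr; apply: Ky => //; rewrite invr_ge0 ltW.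
  move=> x y; rewrite !homE => -[[x0 Kx]|[x0 Kx]] [[y0 Ky]|[y0 Ky]].
  + left; rewrite topD subD.
    set s := top x in x0 Kx *; set t := top y in y0 Ky *.
    have st : 0 < s + t by rewrite addr_gt0.
    split=> //; have -> : (s + t)^-1 *: (usubmx x + usubmx y) =
        (s / (s + t)) *: (s^-1 *: usubmx x) + (t / (s + t)) *: (t^-1 *: usubmx y).
      by rewrite !scalerA scalerDr; congr (_ *: _ + _ *: _); field;
        rewrite ?gt_eqF.
    apply: cK => //; [| | by rewrite -mulrDl divff // gt_eqF];
      by rewrite divr_ge0 // ltW.
  + exact: sum0.
  + by rewrite addrC; exact: sum0.
  + right; rewrite topD subD x0 y0 addr0; split=> // z t Kz t0.
    by rewrite scalerDr addrA; apply: Ky => //; exact: Kx.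
- move=> x t; rewrite le_eqVlt => /orP[/eqP <- _ | t0].
    right; rewrite /top scale0r !linear0 mxE; split=> // z s Kz _.
    by rewrite scaler0 addr0.
  rewrite !homE => -[[x0 Kx]|[x0 Kx]]; [left | right]; rewrite topZ subZ.
    split; first exact: mulr_gt0.
    by rewrite scalerA invfM mulrAC mulVf ?mul1r // gt_eqF.
  rewrite x0 mulr0; split=> // z s Kz s0.
  by rewrite scalerA; apply: Kx => //; rewrite mulr_ge0 // ltW.
Qed.

(** At height 1 the last entry of each row becomes a constant, moved to the right-hand side with its
    sign changed. *)
Lemma polyhedron_slice n (L : seq 'rV[R]_(n + 1)) :
  polyhedron [set x : 'cV[R]_n | polycone L (col_mx x 1%:M)].
Proof.
exists (size L), (\matrix_(i, j) (lsubmx L`_i) 0 j), (\col_i - (rsubmx L`_i) 0 0).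
have valE x (i : 'I_(size L)) : ((\matrix_(i, j) (lsubmx L`_i) 0 j) *m x) i 0 =
    (lsubmx L`_i *m x) 0 0.
  by rewrite !mxE; apply: eq_bigr => j _; rewrite mxE.
have splitE (a : 'rV[R]_(n + 1)) x : (a *m col_mx x 1%:M) 0 0 =
    (lsubmx a *m x) 0 0 + (rsubmx a) 0 0.
  by rewrite -{1}[a]hsubmxK mul_row_col mulmx1 mxE.
rewrite eqEsubset; split=> x Lx.
  move=> i; rewrite valE [leRHS]mxE.
  by have := Lx _ (mem_nth 0 (ltn_ord i)); rewrite splitE; lra.
move=> a /(nthP 0)[i iL <-]; have := Lx (Ordinal iL).
by rewrite valE splitE [leRHS]mxE /=; lra.
Qed.

Lemma int_pointsP n (x : 'cV[R]_n) :
  int_points R n x <-> exists z : 'cV[int]_n, x = real_mx R z.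
Proof.
split=> [xi | [z ->] i]; last by rewrite mxE intr_int.
exists (\col_i Num.floor (x i 0)); apply/matrixP => i j.
by rewrite ord1 !mxE; apply/eqP; rewrite eq_sym -intrEfloor.
Qed.

Lemma real_mxM m n p (A : 'M[int]_(m, n)) (B : 'M[int]_(n, p)) :
  real_mx R (A *m B) = real_mx R A *m real_mx R B.
Proof. exact: map_mxM. Qed.

Lemma cv_le_real_mx n (x y : 'cV[int]_n) :
  cv_le (real_mx R x) (real_mx R y) <-> forall i, x i 0 <= y i 0.
Proof. by split=> h i; have := h i; rewrite !mxE ler_int. Qed.

(* Meyer's theorem. *)
Lemma integer_hull_polyhedron p n (M : 'M[int]_(p, n)) (d : 'cV[int]_p) :
  polyhedron (convex_hull
    [set x : 'cV[R]_n | cv_le (real_mx R M *m x) (real_mx R d) /\ int_points R n x]).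
Proof.
set E := [set x | _].
have EP z : E (real_mx R z) <-> forall i, (M *m z) i 0 <= d i 0.
  rewrite /E /= -real_mxM cv_le_real_mx; split=> [[] // | h]; split=> //.
  by apply/int_pointsP; exists z.
have [F FE Fmin] := conformal_minimal M d setT.
have [H HM Hgen] := hilbert_basis M R.
(* Minimal integer points are put at height 1, generators of the recession cone at height 0. *)
pose gs : seq 'cV[R]_(n + 1) :=
  [seq col_mx (real_mx R f) 1%:M | f <- F] ++ [seq col_mx (real_mx R h) 0 | h <- H].
have [L LE] := cone_polyhedral gs.
suff -> : convex_hull E = [set x | polycone L (col_mx x 1%:M)].
  exact: polyhedron_slice.
rewrite -LE eqEsubset; split.
  apply: convex_hull_min.
    apply/convex_setP => x y a b a0 b0 ab hx hy /=.
    have -> : col_mx (a *: x + b *: y) 1%:M =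
        a *: col_mx x 1%:M + b *: col_mx y 1%:M :> 'cV[R]_(n + 1).
      by rewrite !scale_col_mx add_col_mx -scalerDl ab scale1r.
    by apply: coneD; exact: coneZ.
  move=> x Ex; have [z xz] := (int_pointsP x).1 Ex.2; rewrite xz in Ex *; rewrite /=.
  have [f fF [rM _]] := Fmin z ((EP z).1 Ex) I.
  have -> : col_mx (real_mx R z) 1%:M =
      col_mx (real_mx R f) 1%:M + col_mx (real_mx R (z - f)) 0 :> 'cV[R]_(n + 1).
    by rewrite add_col_mx addr0 -map_mxD addrC subrK.
  apply: coneD; first by apply: cone_gen; rewrite mem_cat (map_f (fun f => col_mx (real_mx R f) 1%:M)).
  (* The combination of [H] that gives [z - f] is lifted to height 0. *)
  apply: (@cone_min _ [seq real_mx R h | h <- H] [set r | cone gs (col_mx r 0)]);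
    last exact: Hgen.
  - by rewrite /= col_mx0; exact: cone0.
  - by move=> x' y' /= /coneD /[apply]; rewrite add_col_mx addr0.
  - by move=> x' t t0 /= /(coneZ t0); rewrite scale_col_mx scaler0.
  - move=> _ /mapP[h hH ->]; apply: cone_gen.
    by rewrite mem_cat (map_f (fun h => col_mx (real_mx R h) 0)) ?orbT.
(* Conversely, all generators lie in the homogenization of the hull, whose slice at height 1 is the
   hull. *)
move=> x /= gsx; suff : homogenization (convex_hull E) (col_mx x 1%:M).
  rewrite /homogenization /= col_mxKu col_mxKd mxE eqxx /= => -[[_]|[]]; last by lra.
  by rewrite invr1 scale1r.
apply: cone_homogenization gsx; first exact: convex_hull_convex.
move=> g; rewrite mem_cat => /orP[] /mapP[z zF ->]; rewrite /homogenization /= col_mxKu col_mxKd mxE.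
  left; rewrite invr1 scale1r; split=> //; apply: convex_hull_sub.
  by apply/EP; exact: (FE _ zF).1.
right; split=> // y t Ky t0; apply: convex_hull_ray => // w' Ew.
have [w ww] := (int_pointsP w').1 Ew.2; move: Ew; rewrite {w'}ww.
rewrite -map_mxD => /EP wE; apply/EP => i.
by rewrite mulmxDr mxE; have := HM _ zF i; have := wE i; lra.
Qed.

End IntegerHull.

(** * Rounding along a totally unimodular matrix *)

(** Total unimodularity speaks of increasing choices of rows and columns; enumerating a set of
    indices provides them. *)
Lemma enum_val_ord_homo n (A : {set 'I_n}) :
  {homo @enum_val _ A : i j / (i < j)%N}.
Proof.
move=> i j ij; have x0 := enum_val i; rewrite !(enum_val_nth x0).
have srt : sorted ltn [seq val k | k <- enum A].
  rewrite sorted_map /enum_mem -enumT; apply: sorted_filter.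
    by move=> a b c; exact: ltn_trans.
  by rewrite -sorted_map val_enum_ord iota_ltn_sorted.
have szA : size (enum A) = #|A| by rewrite cardE.
rewrite -!(nth_map x0 (val x0) val) ?szA ?ltn_ord //.
by apply: sorted_ltn_nth srt _ _ _ _ ij; rewrite ?inE ?size_map ?szA ?ltn_ord //;
  exact: ltn_trans.
Qed.

Section Rounding.
Variable R : realType.

(* Such a direction [v] exists unless the rows on which [N x] is integral have
   full column rank on the fractional coordinates of [x]; a maximal minor is then
   invertible over the integers, which makes those coordinates integral. *)
Lemma totally_unimodular_kernel q n (N : 'M[int]_(q, n)) (x : 'cV[R]_n) :
  totally_unimodular N -> (exists j, x j 0 \isn't a Num.int) ->
  exists v : 'cV[R]_n, [/\ exists j, v j 0 != 0,
    forall j, x j 0 \is a Num.int -> v j 0 = 0 &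
    forall i, (real_mx R N *m x) i 0 \is a Num.int -> (real_mx R N *m v) i 0 = 0].
Proof.
move=> tuN [j0 xj0].
pose J := [set j | x j 0 \isn't a Num.int]%SET.
pose T := [set i | (real_mx R N *m x) i 0 \is a Num.int]%SET.
pose g (k : 'I_#|J|) := enum_val k; pose f (k : 'I_#|T|) := enum_val k.
have j0J : j0 \in J by rewrite inE.
pose B : 'M[R]_(#|T|, #|J|) := mxsub f g (real_mx R N).
have [fullB | nfullB] := boolP (row_full B).
  pose s k := f (fullrankfun fullB k).
  have s_inj : injective s.
    by move=> a b /enum_val_inj /fullrankfun_inj.
  (* The independent rows given by [fullrankfun] come in no stated order; enumerating their set
     yields the increasing choice [h]. *)
  pose I := [set s k | k : 'I_#|J|].
  have cI : #|I| = #|J| by rewrite card_imset // card_ord.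
  pose h k := @enum_val _ I (cast_ord (esym cI) k).
  have h_homo : {homo h : a b / (a < b)%N}.
    by move=> a b ab; apply: enum_val_ord_homo.
  have hT k : h k \in T.
    have /imsetP[k' _ ->] : h k \in I by exact: enum_valP.
    exact: enum_valP.
  pose C := mxsub h g N.
  have Cunit : real_mx R C \in unitmx.
    rewrite -row_full_unit -sub1mx.
    have full := fullrowsub_full fullB; rewrite -sub1mx in full.
    apply: submx_trans full _; apply/row_subP => k.
    have skI : s k \in I by exact: imset_f.
    suff -> : row k (rowsub (fullrankfun fullB) B) =
        row (cast_ord cI (enum_rank_in skI (s k))) (real_mx R C) by exact: row_sub.
    by apply/rowP => j; rewrite !mxE /h cast_ordK enum_rankK_in.
  (* The determinant 0 is excluded by invertibility over [R], which leaves 1 and -1. *)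
  have detC : \det C \is a GRing.unit.
    have := tuN _ h g h_homo (@enum_val_ord_homo _ J).
    rewrite -/C !inE => /or3P[] /eqP dC; rewrite dC // in Cunit *.
    by move: Cunit; rewrite unitmxE det_map_mx dC rmorph0 unitr0.
  pose y : 'cV[R]_#|J| := \col_k x (g k) 0.
  pose c : 'cV[R]_#|J| := real_mx R C *m y.
  have cint k : c k 0 \is a Num.int.
    (* The coordinates outside [J] are integral and contribute an integer to the integral row, so
       the part over [J] is an integer too. *)
    have := hT k; rewrite inE !mxE (bigID (mem J)) /= big_enum_val /= => Nxi.
    have -> : \sum_j real_mx R C k j * y j 0 =
        \sum_(j < #|J|) real_mx R N (h k) (enum_val j) * x (enum_val j) 0.
      by apply: eq_bigr => j _; rewrite !mxE.
    move: Nxi; rewrite rpredDr //; apply: rpred_sum => j.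
    by rewrite inE negbK => xj; rewrite mxE rpredM ?intr_int.
  have [z cz] := (int_pointsP c).1 cint.
  have yz : y = real_mx R (invmx C *m z).
    by rewrite real_mxM -cz /c mulmxA -real_mxM mulVmx // /real_mx map_mx1 mul1mx.
  have : y (enum_rank_in j0J j0) 0 \is a Num.int by rewrite yz mxE intr_int.
  by rewrite mxE /g enum_rankK_in // (negPf xj0).
have [w w0 Bw] : exists2 w : 'cV[R]_#|J|, w != 0 & B *m w = 0.
  have /matrix0Pn[a [b ab]] : cokermx B != 0.
    rewrite -mxrank_eq0 mxrank_coker subn_eq0 -ltnNge ltn_neqAle rank_leq_col.
    by rewrite andbT; exact: nfullB.
  exists (col b (cokermx B)); first by apply/matrix0Pn; exists a, 0; rewrite mxE.
  by rewrite colE mulmxA mulmx_coker mul0mx.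
(* [G] extends a vector indexed by [J] by zero to all coordinates. *)
pose G : 'M[R]_(n, #|J|) := \matrix_(j, k) (j == g k)%:R.
exists (G *m w); split.
- have /matrix0Pn[k [k' wk]] := w0; rewrite ord1 in wk; exists (g k).
  rewrite mxE (bigD1 k) //= mxE eqxx mul1r big1 ?addr0 // => k1 k1k.
  by rewrite mxE (inj_eq enum_val_inj) eq_sym (negPf k1k) mul0r.
- move=> j xj; rewrite mxE big1 // => k _; rewrite mxE.
  have : g k \in J by exact: enum_valP.
  by case: eqP => [<-|]; rewrite ?inE ?xj ?mul0r.
- move=> i Ti; rewrite mulmxA.
  have iT : i \in T by rewrite inE.
  have -> : i = f (enum_rank_in iT i) by rewrite /f enum_rankK_in.
  transitivity ((B *m w) (enum_rank_in iT i) 0); last by rewrite Bw mxE.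
  rewrite [LHS]mxE [RHS]mxE; apply: eq_bigr => k _; congr (_ * _).
  rewrite [RHS]mxE [LHS]mxE (bigD1 (g k)) //= [G _ _]mxE eqxx mulr1.
  by rewrite big1 ?addr0 // => j jk; rewrite [G _ _]mxE (negPf jk) mulr0.
Qed.

(** Equivalent to staying between floor and ceiling in every row. Phrased by integer bounds, it is
    visibly transitive and applies directly to integer right-hand sides. *)
Definition rounds_within q n (G : 'M[R]_(q, n)) (x y : 'cV[R]_n) : Prop :=
  forall i (c : int), ((G *m x) i 0 <= c%:~R -> (G *m y) i 0 <= c%:~R) /\
    (c%:~R <= (G *m x) i 0 -> c%:~R <= (G *m y) i 0).

Definition fractional_rows q n (G : 'M[R]_(q, n)) (x : 'cV[R]_n) : {set 'I_q} :=
  [set i | (G *m x) i 0 \isn't a Num.int]%SET.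

(** The step is the first time at which some moving row becomes integral. No other row has passed
    its next integer by then, and integral rows stay fixed. *)
Lemma round_along q n (G : 'M[R]_(q, n)) (x v : 'cV[R]_n) :
  (forall i, (G *m x) i 0 \is a Num.int -> (G *m v) i 0 = 0) ->
  (exists i, (G *m v) i 0 != 0) ->
  exists t, [/\ 0 < t, rounds_within G x (x + t *: v) &
    fractional_rows G (x + t *: v) \proper fractional_rows G x].
Proof.
move=> vint [i0 vi0]; pose a i : R := (G *m x) i 0; pose d i : R := (G *m v) i 0.
(* The integer that row [i] meets first: the ceiling if the row increases along [v], the floor
   otherwise. *)
pose target i : R :=
  if 0 < d i then (Num.Def.ceil (a i))%:~R else (Num.Def.floor (a i))%:~R.
pose tau i := (target i - a i) / d i.
have tau_gt0 i : d i != 0 -> 0 < tau i.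
  move=> di; have ai : a i \isn't a Num.int by apply: contra_neqN di => /vint.
  rewrite /tau /target; case: (ltgtP 0 (d i)) (di) => // di0 _.
    by rewrite divr_gt0 // subr_gt0 lt_neqAle ceil_ge eq_sym -intrEceil ai.
  by rewrite ltr_ndivlMr // mul0r subr_lt0 lt_neqAle floor_le -intrEfloor ai.
have xtE t i : (G *m (x + t *: v)) i 0 = a i + t * d i.
  by rewrite mulmxDr -scalemxAr mxE [X in _ + X]mxE.
have [i di tau_min] := @arg_minP _ _ _ i0 (fun i => d i != 0) tau vi0.
exists (tau i); split; first exact: tau_gt0.
- move=> j c; rewrite xtE; have t0 := tau_gt0 _ di.
  have [dj0 | dj] := eqVneq (d j) 0; first by rewrite dj0 mulr0 addr0.
  have := tau_min j dj; rewrite {2}/tau /target -/(a j).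
  case: (ltgtP 0 (d j)) (dj) => // dj0 _.
    rewrite ler_pdivlMr // lerBrDl => hj; split=> hc.
      by apply: le_trans hj _; rewrite ler_int ceil_le_int.
    by apply: le_trans hc _; rewrite lerDl mulr_ge0 // ltW.
  rewrite ler_ndivlMr // lerBlDl => hj; split=> hc.
    by apply: le_trans hc; rewrite gerDl nmulr_lle0 // ltW.
  by apply: le_trans hj; rewrite ler_int floor_ge_int.
- apply/properP; split.
    apply/fintype.subsetP => j; rewrite !inE xtE; apply: contra => aj.
    by rewrite /d (vint _ aj) mulr0 addr0.
  exists i; rewrite inE; first by apply: contra_neqN di => /vint.
  rewrite negbK xtE divfK // addrC subrK /target.
  by case: ifP; rewrite intr_int.
Qed.

Lemma rounds_within_trans q n (G : 'M[R]_(q, n)) x y z :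
  rounds_within G x y -> rounds_within G y z -> rounds_within G x z.
Proof.
by move=> xy yz i c; split=> [/(xy i c).1 /(yz i c).1 | /(xy i c).2 /(yz i c).2].
Qed.

Lemma rounding_hull q n (G : 'M[R]_(q, n)) :
  (forall x, fractional_rows G x != finset.set0 -> exists v : 'cV[R]_n,
    (exists i, (G *m v) i 0 != 0) /\
    forall i, (G *m x) i 0 \is a Num.int -> (G *m v) i 0 = 0) ->
  forall x, convex_hull
    [set y | rounds_within G x y /\ fractional_rows G y = finset.set0] x.
Proof.
move=> dir x; have [N] := ubnP #|fractional_rows G x|.
elim: N x => // N IH x; rewrite ltnS => xN.
have [x0 | /dir[v [v0 vint]]] := eqVneq (fractional_rows G x) finset.set0.
  by apply: convex_hull_sub; split.
have side w : (forall i, (G *m x) i 0 \is a Num.int -> (G *m w) i 0 = 0) ->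
    (exists i, (G *m w) i 0 != 0) -> exists2 t, 0 < t & convex_hull
    [set y | rounds_within G x y /\ fractional_rows G y = finset.set0] (x + t *: w).
  move=> wint w0; have [t [t0 xt /proper_card xtN]] := round_along wint w0.
  exists t => //; apply: (convex_hull_incl _ (IH _ (leq_trans xtN xN))).
  move=> y [xy y0]; apply: convex_hull_sub; split=> //.
  exact: rounds_within_trans xy.
have [s s0 hs] := side v vint v0.
have [|| t t0 ht] := side (- v).
- by move=> i /vint vi; rewrite mulmxN mxE vi oppr0.
- by have [i vi] := v0; exists i; rewrite mulmxN mxE oppr_eq0.
have st : 0 < s + t by rewrite addr_gt0.
set K := (X in convex_hull X) in hs ht *.
(* Each endpoint is weighted by the length of the opposite step, so the two displacements cancel. *)
have -> : x = (t / (s + t)) *: (x + s *: v) + (s / (s + t)) *: (x + t *: - v).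
  rewrite !scalerDr !scalerA addrACA -scalerDl scalerN -scalerBl.
  have -> : t / (s + t) + s / (s + t) = 1 by field; rewrite gt_eqF.
  have -> : t / (s + t) * s - s / (s + t) * t = 0 by field; rewrite gt_eqF.
  by rewrite scale1r scale0r addr0.
apply: convex_hull_comb => //; try by rewrite divr_ge0 // ltW.
by field; rewrite gt_eqF.
Qed.

(** Stacking the identity on [N] treats the coordinates as rows: a point without fractional rows is
    then an integer point, and bounds on the coordinates are preserved along with those on [N]. *)
Lemma totally_unimodular_rounding q n (N : 'M[int]_(q, n)) (x : 'cV[R]_n) :
  totally_unimodular N ->
  convex_hull [set y | [/\ int_points R n y, rounds_within 1%:M x y &
    rounds_within (real_mx R N) x y]] x.
Proof.
move=> tuN; pose G := col_mx 1%:M (real_mx R N).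
have GE y : G *m y = col_mx y (real_mx R N *m y) by rewrite mul_col_mx mul1mx.
have dir y : fractional_rows G y != finset.set0 -> exists v : 'cV[R]_n,
    (exists i, (G *m v) i 0 != 0) /\
    forall i, (G *m y) i 0 \is a Num.int -> (G *m v) i 0 = 0.
  move=> /set0Pn[i]; rewrite inE GE => Gyi.
  have [j yj] : exists j, y j 0 \isn't a Num.int.
    apply/not_existsP => yint; move/negP: Gyi; apply.
    have yi j : y j 0 \is a Num.int by apply/negPn/negP/yint.
    rewrite mxE; case: splitP => k _; first exact: yi.
    by rewrite mxE rpred_sum // => j _; rewrite mxE rpredM ?intr_int.
  have [v [[j' vj'] vJ vT]] := totally_unimodular_kernel tuN (ex_intro _ j yj).
  exists v; rewrite GE; split; first by exists (lshift q j'); rewrite col_mxEu.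
  move=> k; case: (split_ordP k) => k' ->.
    by rewrite !col_mxEu; exact: vJ.
  by rewrite !col_mxEd; exact: vT.
apply: (convex_hull_incl _ (@rounding_hull _ _ _ dir x)) => y [xy y0].
apply: convex_hull_sub; split.
- move=> i; have /setP/(_ (lshift q i)) := y0.
  by rewrite !inE GE col_mxEu => /negbFE.
- by move=> i c; have := xy (lshift q i) c; rewrite !GE !col_mxEu !mul1mx.
- by move=> i c; have := xy (rshift n i) c; rewrite !GE !col_mxEd.
Qed.

End Rounding.

(** * From extended bounds to an integer system, and the final assembly *)

Lemma bounded_system_matrix (R : realType) (m n : nat) (A : 'M[int]_(m, n))
    (b : 'cV[int]_m) (l u : 'cV[\bar int]_n) :
  (forall j, l j 0 <> +oo%E) -> (forall j, u j 0 <> -oo%E) ->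
  exists q (M : 'M[int]_(q, n)) (d : 'cV[int]_q),
    bounded_system R A b l u = [set x | cv_le (real_mx R M *m x) (real_mx R d)].
Proof.
move=> hl hu.
(* An infinite bound becomes the trivial row [0 <= 0], which is faithful because [l j 0] is never
   [+oo] and [u j 0] never [-oo]. *)
pose L : 'M[int]_n := diag_mx (\row_i (if l i 0 is EFin _ then -1 else 0)).
pose U : 'M[int]_n := diag_mx (\row_i (if u i 0 is EFin _ then 1 else 0)).
pose dl : 'cV[int]_n := \col_i (if l i 0 is EFin c then - c else 0).
pose du : 'cV[int]_n := \col_i (if u i 0 is EFin c then c else 0).
exists (m + (n + n))%N, (col_mx A (col_mx L U)), (col_mx b (col_mx dl du)).
have rE (x : 'cV[R]_n) : real_mx R (col_mx A (col_mx L U)) *m x =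
    col_mx (real_mx R A *m x) (col_mx (real_mx R L *m x) (real_mx R U *m x)).
  by rewrite /real_mx !map_col_mx !mul_col_mx.
have dE : real_mx R (col_mx b (col_mx dl du)) =
    col_mx (real_mx R b) (col_mx (real_mx R dl) (real_mx R du)).
  by rewrite /real_mx !map_col_mx.
have LE (x : 'cV[R]_n) j : ((real_mx R L *m x) j 0 <= real_mx R dl j 0) =
    (er_map intr (l j 0%R) <= (x j 0%R)%:E)%E.
  rewrite /real_mx map_diag_mx mul_diag_mx !mxE; have := hl j.
  case: (l j 0) => [c||] //= _; last by rewrite mul0r lexx leNye.
  by rewrite lee_fin !intrN mulN1r lerN2.
have UE (x : 'cV[R]_n) j : ((real_mx R U *m x) j 0 <= real_mx R du j 0) =
    ((x j 0%R)%:E <= er_map intr (u j 0%R))%E.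
  rewrite /real_mx map_diag_mx mul_diag_mx !mxE; have := hu j.
  case: (u j 0) => [c||] //= _; last by rewrite mul0r lexx leey.
  by rewrite lee_fin mul1r.
rewrite eqEsubset; split=> x; rewrite /= rE dE.
  move=> [xlu xb] i; case: (split_ordP i) => i1 ->; first by rewrite !col_mxEu; exact: xb.
  rewrite !col_mxEd; case: (split_ordP i1) => j ->.
    by rewrite !col_mxEu LE; exact: (xlu j).1.
  by rewrite !col_mxEd UE; exact: (xlu j).2.
move=> xle; split=> [j | i]; last by have := xle (lshift _ i); rewrite !col_mxEu.
split; [rewrite -LE; have := xle (rshift m (lshift n j)) |
        rewrite -UE; have := xle (rshift m (rshift n j))];
  by rewrite !col_mxEd ?col_mxEu ?col_mxEd.
Qed.

Theorem theorem2 (R : realType) (m n k : nat)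
    (A At : 'M[int]_(m, n)) (U : 'M[int]_(m, k)) (W : 'M[int]_(k, n))
    (hA : affine_TU_decomposition A At U W)
    (b : 'cV[int]_m) (l u : 'cV[\bar int]_n)
    (hl : forall j, l j 0 <> +oo%E) (hu : forall j, u j 0 <> -oo%E)
    (hlu : forall j, (l j 0%R <= u j 0%R)%E) :
  let P : set 'cV[R]_n := bounded_system R A b l u in
  let S : set 'cV[R]_n := [set x : 'cV[R]_n | P x /\ int_points R k (real_mx R W *m x)] in
  integral_polyhedron (convex_hull S) /\ convex_hull (P `&` int_points R n) = convex_hull S.
Proof.
move=> P S; have [AE _ tuN] := hA.
have PIS : P `&` int_points R n `<=` S.
  move=> x [Px /int_pointsP[z xz]]; split=> //; apply/int_pointsP.
  by exists (W *m z); rewrite xz real_mxM.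
have SPI : S `<=` convex_hull (P `&` int_points R n).
  move=> x [[xlu xb] /int_pointsP[z Wxz]].
  have := totally_unimodular_rounding (x := x) tuN; apply: convex_hull_incl.
  move=> y [yint x1y xNy]; apply: convex_hull_sub; split=> //; split=> [j | i].
    have xy c := x1y j c; rewrite !mul1mx in xy; have [] := xlu j.
    case: (l j 0) => [cl||] /=; case: (u j 0) => [cu||] //=; rewrite ?lee_fin ?leNye ?leey;
      by move=> ? ?; split=> //; (apply: (xy _).1 || apply: (xy _).2).
  have NE (v : 'cV[R]_n) : real_mx R (col_mx At W) *m v =
      col_mx (real_mx R At *m v) (real_mx R W *m v).
    by rewrite /real_mx map_col_mx mul_col_mx.
  (* [W x] equals the integer vector [z], so rounding with [z] as both upper and lower bound keeps
     [y] on the same slice. *)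
  have Wyz : real_mx R W *m y = real_mx R z.
    apply/matrixP => i' j; rewrite ord1.
    have [] := xNy (rshift m i') (z i' 0); rewrite !NE !col_mxEd Wxz.
    have -> : real_mx R z i' 0 = (z i' 0)%:~R by rewrite mxE.
    by move=> /(_ (lexx _)) h1 /(_ (lexx _)) h2; apply/eqP; rewrite eq_le h1 h2.
  have AvE (v : 'cV[R]_n) : real_mx R W *m v = real_mx R z ->
      (real_mx R A *m v) i 0 = (real_mx R At *m v) i 0 + ((U *m z) i 0)%:~R.
    move=> Wv; rewrite AE {1}/real_mx map_mxD -/(real_mx _ _) -/(real_mx _ _).
    by rewrite mulmxDl real_mxM -mulmxA Wv -real_mxM mxE [X in _ + X]mxE.
  (* On this slice row [i] of [A] reads as a row of [At] with the integer bound [b - U z], which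
     rounding respects. *)
  have := xb i; rewrite !AvE // [leRHS]mxE -lerBrDr -intrB.
  have := (xNy (lshift k i) (b i 0 - (U *m z) i 0)).1.
  by rewrite !NE !col_mxEu [X in _ -> _ -> _ <= X]mxE -lerBrDr -intrB.
have hullE : convex_hull (P `&` int_points R n) = convex_hull S.
  rewrite eqEsubset; split; apply: convex_hull_incl => //.
  by move=> x /PIS; exact: convex_hull_sub.
split=> //; split.
  have [q [M [d PE]]] := bounded_system_matrix R A b hl hu.
  by rewrite -hullE /P PE; exact: integer_hull_polyhedron.
(* The integer points of [P] are integer points of the hull, and every integer point of the hull
   lies in the hull. *)
rewrite -hullE eqEsubset; split; apply: convex_hull_incl => x.
  by move=> PIx; apply: convex_hull_sub; split; [exact: convex_hull_sub | case: PIx].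
by case.
Qed.
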